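(* Let $t \in \mathbb{N}$. There exists a constant $c = c(t)$, depending only on $t$, such that for all $p \in \mathbb{N}$ with $p \geqslant 3$ and all $n \in \mathbb{N}$, if $G$ is a $K_{p}$-saturated graph of order $n$ with minimum degree at least $t$, then $e(G) \geqslant tn - c$.
   Context: Graphs are finite and simple. $K_p$ denotes the complete graph on $p$ vertices, and $e(G)$ denotes the number of edges of $G$. The order of $G$ is its number of vertices. A graph $G$ is $H$-saturated if it contains no copy of $H$ as a (not necessarily induced) subgraph, but the addition of any new edge to $G$ (between two distinct non-adjacent vertices of $G$) creates a copy of $H$. *)

(* Defs.v *)
From HB Require Import structures.
From mathcomp Require Import all_boot.

Set Implicit Arguments.
Unset Strict Implicit.
Unset Printing Implicit Defensive.

Record sgraph (V : finType) := SGraph {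
  adj :> rel V;
  adj_sym : symmetric adj;
  adj_irrefl : irreflexive adj }.

Definition edges (V : finType) (G : sgraph V) : {set {set V}} :=
  [set [set u.1; u.2] | u : V * V & G u.1 u.2].

Definition degree (V : finType) (G : sgraph V) (x : V) : nat := #|[set y | G x y]|.

Definition min_degree_at_least (V : finType) (G : sgraph V) (t : nat) : Prop :=
  forall x : V, t <= degree G x.

Definition complete_rel (p : nat) : rel 'I_p := fun i j => i != j.

Lemma complete_sym p : symmetric (@complete_rel p).
Proof. by move=> i j; rewrite /complete_rel eq_sym. Qed.

Lemma complete_irrefl p : irreflexive (@complete_rel p).
Proof. by move=> i; rewrite /complete_rel eqxx. Qed.

Definition complete_graph (p : nat) : sgraph 'I_p :=
  SGraph (@complete_sym p) (@complete_irrefl p).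

(* The guard [u != v] only matters when [x = y], where no edge is added. *)
Definition add_edge_rel (V : finType) (G : sgraph V) (x y : V) : rel V :=
  fun u v => G u v || (u != v) && ([set u; v] == [set x; y]).

Lemma add_edge_sym (V : finType) (G : sgraph V) (x y : V) :
  symmetric (add_edge_rel G x y).
Proof. by move=> u v; rewrite /add_edge_rel adj_sym eq_sym setUC. Qed.

Lemma add_edge_irrefl (V : finType) (G : sgraph V) (x y : V) :
  irreflexive (add_edge_rel G x y).
Proof. by move=> u; rewrite /add_edge_rel adj_irrefl eqxx. Qed.

Definition add_edge (V : finType) (G : sgraph V) (x y : V) : sgraph V :=
  SGraph (add_edge_sym G x y) (add_edge_irrefl G x y).

(* Not necessarily induced: non-edges of [H] are unconstrained. *)
Definition contains_copy (W V : finType) (H : sgraph W) (G : sgraph V) : Prop :=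
  exists f : W -> V, injective f /\ {homo f : i j / H i j >-> G i j}.

Definition saturated (W V : finType) (H : sgraph W) (G : sgraph V) : Prop :=
  ~ contains_copy H G /\
  forall x y : V, x != y -> ~~ G x y -> contains_copy H (add_edge G x y).

(* Main.v *)
Require Import Defs.
From HB Require Import structures.
From mathcomp Require Import all_boot.
From mathcomp Require Import zify.

Set Implicit Arguments.
Unset Strict Implicit.
Unset Printing Implicit Defensive.

(** Grow a vertex set [C] by absorbing, again and again, any vertex with at
    least [t] neighbours in [C]. Each absorbed vertex pays for itself with [t]
    new edges, so if [C] was seeded with boundedly many vertices, the edges
    inside [C] number at least [t * #|C|] up to a constant; such a set, stable
    under absorption, is a [core] (its parameter [k] is twice the constant). A vertex
    [x] outside [C] may be charged all its edges to [C] and half of its other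
    edges, and this covers its share [t] unless
    [degree G x + #|nbhd G x :&: C| < 2 * t]: then [x] is [light]. If there are
    no light vertices, the theorem follows ([core_no_light]). So it is enough to
    reach, from boundedly many seeds in all, a core without light vertices.

    This takes a number of rounds that depends on [t] only. Call [x] and [y]
    [near] when a closed neighbour of [x] and one of [y], both outside [C], are
    adjacent. In each round, choose a maximal set [S] of light vertices no two
    of which are near, add the closed neighbourhoods of the members of [S] to
    [C], and absorb again. Every light vertex [x] is near some member of [S], so
    some closed neighbour of [x] outside [C] gains a neighbour in the core. A
    vertex can gain fewer than [t] times before it is absorbed, and a light
    vertex has at most [2 * t] closed neighbours, so [x] can stay light for only
    [2 * t * t] rounds; [potential] counts the gains.

    What remains is to bound [#|S|], and this is where saturation enters
    ([far_light_bound]). Each [y] in [S] has a neighbour [z y] outside [C],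
    because its degree is at least [t]. For [x] in [S] other than [y], the
    vertices [x] and [z y] are not adjacent, since [x] and [y] are not near; so
    they have a clique of size [p - 2] in common, and it lies inside [C], again
    since [x] and [y] are not near. On the other hand [y] and [z y] are
    adjacent, so they have no such clique in common. Hence the families of
    [p - 2]-cliques in the traces on [C] of the neighbourhoods of [x] and of
    [z y] intersect exactly when [x != y]. These traces have fewer than [t]
    vertices, so the families have at most [2 ^ t] members whatever [p] is, and
    a set-pair inequality in the style of Bollobas ([set_pair_bound]) bounds
    [#|S|]. *)

(** * A set-pair inequality *)

Lemma leq_card_bigcup (I T : finType) (P : pred I) (F : I -> {set T}) (k : nat) :
  (forall i, P i -> #|F i| <= k) -> #|\bigcup_(i | P i) F i| <= #|P| * k.
Proof.
move=> leF; rewrite -sum_nat_const.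
apply: (@leq_trans (\sum_(i | P i) #|F i|)); last exact: leq_sum.
elim/big_rec2: _ => [|i m U _ leUm]; first by rewrite cards0.
by rewrite (leq_trans (leq_card_setU _ _)) ?leq_add2l.
Qed.

(** Fix [s] in [S]. Every other [B y] meets [A s], so some [v] in [A s] lies in
    many of the [B y]. For these [y] the set [A y] avoids [v], so removing [v]
    from the [B y] preserves the hypotheses and lowers [b] by one. The bound
    obtained is far from the binomial one, but also depends on [a] and [b]
    alone. *)
Lemma set_pair_bound (I T : finType) (A B : I -> {set T}) (a b : nat)
    (S : {set I}) :
  {in S, forall x, #|A x| <= a} -> {in S, forall x, #|B x| <= b} ->
  {in S, forall x, [disjoint A x & B x]} ->
  {in S &, forall x y, x != y -> ~~ [disjoint A x & B y]} ->
  #|S| <= a.+1 ^ b.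
Proof.
elim: b B S => [|b IHb] B S leA leB dAB mAB;
  (case: (set_0Vmem S) => [->|[s Ss]]; first by rewrite cards0).
  rewrite expn0 leqNgt; apply/negP=> /card_gt1P[x [y [Sx Sy xNy]]].
  have := leB y Sy; rewrite leqn0 cards_eq0 => /eqP By0.
  by have := mAB x y Sx Sy xNy; rewrite By0 disjoint_sym disjoints_subset sub0set.
pose S' v := [set y in S | v \in B y].
have sSS' : S :\ s \subset \bigcup_(v in A s) S' v.
  apply/subsetP=> y; rewrite !inE eq_sym => /andP[sNy Sy].
  have /pred0Pn[v /andP[Av Bv]] := mAB s y Ss Sy sNy.
  by apply/bigcupP; exists v; rewrite // inE Sy.
have leS' v : #|S' v| <= a.+1 ^ b.
  apply: (IHb (fun y => B y :\ v)) => [x|x|x|x y]; rewrite !inE.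
  - by case/andP=> /leA.
  - by case/andP=> /leB; rewrite (cardsD1 v) => + vB; rewrite vB.
  - case/andP=> /dAB dx _; apply: disjointWr dx; exact: subsetDl.
  case/andP=> Sx vBx /andP[Sy _] /(mAB x y Sx Sy) /pred0Pn[w /andP[/= Aw Bw]].
  apply/pred0Pn; exists w; rewrite /= Aw !inE Bw andbT.
  by apply: contraL vBx => /eqP<-; rewrite (disjointFr (dAB x Sx) Aw).
have le1 : #|S :\ s| <= a * a.+1 ^ b.
  apply: leq_trans (subset_leq_card sSS') _.
  apply: leq_trans (leq_card_bigcup (fun v _ => leS' v)) _.
  by rewrite leq_mul2r leA ?orbT.
rewrite (cardsD1 s) Ss expnS mulSn leq_add // expn_gt0 //.
Qed.

(** * Arcs between vertex sets *)

Definition nbhd (V : finType) (G : sgraph V) (x : V) : {set V} := [set y | G x y].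

Definition arcs (V : finType) (G : sgraph V) (A B : {set V}) : nat :=
  \sum_(x in A) #|nbhd G x :&: B|.

Section Arcs.

Variables (V : finType) (G : sgraph V).
Implicit Types (x y : V) (A B C : {set V}).

Local Notation N := (nbhd G).

Lemma arcsC A B : arcs G A B = arcs G B A.
Proof.
have arcsE C D : arcs G C D = \sum_(x in C) \sum_(y in D) G x y.
  apply: eq_bigr => x _; rewrite -sum1_card [RHS]big_mkcond [LHS]big_mkcond.
  by apply: eq_bigr => y _; rewrite !inE; case: (G x y); case: (y \in D).
rewrite !arcsE exchange_big; apply: eq_bigr => y _.
by apply: eq_bigr => x _; rewrite adj_sym.
Qed.

Lemma arcsUl A B C : [disjoint A & B] ->
  arcs G (A :|: B) C = arcs G A C + arcs G B C.
Proof.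
move=> dAB; rewrite /arcs (eq_bigl [predU A & B]) ?bigU //.
by move=> x; rewrite !inE.
Qed.

Lemma arcsU A B : [disjoint A & B] ->
  arcs G (A :|: B) (A :|: B) = arcs G A A + 2 * arcs G B A + arcs G B B.
Proof.
move=> dAB; rewrite arcsUl // ![arcs G _ (A :|: B)]arcsC !arcsUl //.
rewrite (arcsC A B); lia.
Qed.

Lemma arcs_mono A B : A \subset B -> arcs G A A <= arcs G B B.
Proof.
move=> sAB; rewrite /arcs [leqRHS](big_setID A) /= (setIidPr sAB).
apply: leq_trans (leq_addr _ _); apply: leq_sum => x _.
exact/subset_leq_card/setIS.
Qed.

(** An edge carries at most the two arcs [(a, b)] and [(b, a)]. *)
Lemma arcsT : arcs G setT setT <= 2 * #|edges G|.
Proof.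
have -> : arcs G setT setT = #|[set u : V * V | G u.1 u.2]|.
  rewrite -sum1dep_card -(pair_big_dep xpredT G (fun _ _ => 1)) /=.
  rewrite /arcs big_mkcond; apply: eq_bigr => x _.
  by rewrite inE setIT -sum1_card; apply: eq_bigl => y; rewrite inE.
rewrite mulnC; pose f (u : V * V) := [set u.1; u.2].
set D := [set u : V * V | _].
have fD u : u \in D -> f u \in edges G.
  by move=> Du; apply: imset_f.
rewrite -sum1_card (partition_big f (mem (edges G)) fD) /=.
rewrite -sum_nat_const; apply: leq_sum => e /imsetP[[a b] Gab ->] /=.
rewrite sum1_card.
have : #|[set (a, b); (b, a)]| <= 2 by rewrite cards2; case: (_ != _).
apply: leq_trans; apply/subset_leq_card/subsetP=> -[c d].
rewrite !inE /f /= => /andP[+ /eqP/setP E]; rewrite inE /= => Gcd.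
have := E c; have := E d; have := E a; have := E b; rewrite !inE !eqxx /= !orbT.
rewrite !xpair_eqE; have := adj_irrefl G c.
case: (eqVneq c d) Gcd => [<-|_ _ _]; first by move=> /= ->.
rewrite (eq_sym a c) (eq_sym a d) (eq_sym b c) (eq_sym b d).
by case: (c == a); case: (d == b); case: (c == b); case: (d == a).
Qed.

End Arcs.

(** * Common cliques in saturated graphs *)

Section Cliques.

Variables (V : finType) (G : sgraph V).
Implicit Types (x y : V) (Q : {set V}).

Local Notation N := (nbhd G).

Definition clique Q : bool :=
  [forall u in Q, forall v in Q, (u != v) ==> G u v].

Lemma cliqueP Q : reflect {in Q &, forall u v, u != v -> G u v} (clique Q).
Proof.
apply: (iffP forall_inP) => [cQ u v Qu Qv uNv | cQ u Qu].
  by have /forall_inP/(_ v Qv)/implyP := cQ u Qu; apply.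
by apply/forall_inP=> v Qv; apply/implyP; apply: cQ.
Qed.

Lemma clique_copy Q : clique Q -> contains_copy (complete_graph #|Q|) G.
Proof.
move/cliqueP=> cQ; exists enum_val; split=> [|i j]; first exact: enum_val_inj.
by rewrite /= /complete_rel => iNj; rewrite cQ ?enum_valP // (inj_eq enum_val_inj).
Qed.

(** The copy created by the edge [xy] must use that edge, or it would lie in
    [G]; its [p - 2] other vertices form the clique. *)
Lemma saturated_nonadj p x y : saturated (complete_graph p) G ->
  x != y -> ~~ G x y ->
  exists Q, [/\ clique Q, #|Q| = p.-2 & Q \subset N x :&: N y].
Proof.
case=> noK satG xNy nGxy; have [f [f_inj f_hom]] := satG x y xNy nGxy.
(* Both ends of the new edge are in the copy. *)
have uses z : z \in [set x; y] -> z \in f @: [set: 'I_p].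
  move=> xyz; apply/negPn/negP=> nfz; case: noK; exists f; split=> // i j ij.
  have /orP[//|/andP[_ /eqP/setP/(_ z)]] := f_hom i j ij.
  rewrite xyz !inE => /orP[] /eqP zE; case/negP: nfz; rewrite zE; exact: imset_f.
pose Q := f @: [set: 'I_p] :\: [set x; y].
have adjQ z u : z \in [set x; y] -> u \in Q -> G z u.
  move=> xyz; have /imsetP[i _ zE] := uses z xyz.
  case/setDP=> /imsetP[j _ uE] nu.
  have zNu : z != u by apply: contraNneq nu => <-.
  have iNj : i != j by apply: contraNneq zNu => ij; rewrite zE uE ij.
  have := f_hom i j iNj; rewrite -zE -uE => /orP[//|/andP[_ /eqP/setP/(_ u)]].
  by rewrite (negPf nu) !inE eqxx orbT.
exists Q; split.
- apply/cliqueP=> _ _ /setDP[/imsetP[i _ ->] ni] /setDP[/imsetP[j _ ->] _] fNij.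
  have iNj : i != j by apply: contraNneq fNij => ->.
  have /orP[//|/andP[_ /eqP/setP/(_ (f i))]] := f_hom i j iNj.
  by rewrite (negPf ni) !inE eqxx.
- rewrite /Q cardsDS; last by apply/subsetP.
  by rewrite card_imset // cardsT card_ord cards2 xNy subn2.
apply/subsetP=> u Qu; rewrite !inE !adjQ // !inE eqxx ?orbT //.
Qed.

Lemma saturated_adj p x y Q : 1 < p -> saturated (complete_graph p) G ->
  G x y -> clique Q -> Q \subset N x :&: N y -> #|Q| != p.-2.
Proof.
move=> p2 [noK _] Gxy /cliqueP cQ /subsetP sQ; apply/eqP=> cardQ; apply: noK.
have Qx u : u \in Q -> G x u by move/sQ; rewrite !inE => /andP[].
have Qy u : u \in Q -> G y u by move/sQ; rewrite !inE => /andP[].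
have nQx : x \notin Q by apply/negP=> /Qx; rewrite adj_irrefl.
have nQy : y \notin Q by apply/negP=> /Qy; rewrite adj_irrefl.
have xNy : x != y by apply: contraTneq Gxy => ->; rewrite adj_irrefl.
have <- : #|x |: (y |: Q)| = p.
  by rewrite !cardsU1 !inE (negPf xNy) (negPf nQx) nQy cardQ /=; lia.
apply: clique_copy; apply/cliqueP=> u v; rewrite !inE.
case/or3P=> [/eqP->|/eqP->|Qu]; case/or3P=> [/eqP->|/eqP->|Qv]; rewrite ?eqxx //.
- by move=> _; apply: Qx.
- by rewrite adj_sym.
- by move=> _; apply: Qy.
- by rewrite adj_sym => _; apply: Qx.
- by rewrite adj_sym => _; apply: Qy.
exact: cQ.
Qed.

End Cliques.

(** * Cores and light vertices *)

Section Core.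

Variables (V : finType) (G : sgraph V) (t : nat).
Implicit Types (x y w z : V) (C D S : {set V}) (k : nat).

Local Notation N := (nbhd G).

(** Both sides of the edge inequality are doubled, since [arcs] counts each
    edge inside [C] twice. *)
Definition core k C : bool :=
  (2 * t * #|C| <= arcs G C C + k) && [forall x, (x \notin C) ==> (#|N x :&: C| < t)].

Lemma core_out k C x : core k C -> x \notin C -> #|N x :&: C| < t.
Proof. by case/andP=> _ /forallP/(_ x)/implyP. Qed.

(** A maximal superset of [C :|: S] that still satisfies the inequality is
    stable: adding a vertex with [t] neighbours in it adds at least [2 * t] arcs,
    which balances the growth of the left-hand side. *)
Lemma core_extend k C S : 2 * t * #|C| <= arcs G C C + k ->
  exists2 D : {set V}, C :|: S \subset D & core (k + 2 * t * #|S|) D.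
Proof.
move=> leC; set k' := k + _.
pose P D := (C :|: S \subset D) && (2 * t * #|D| <= arcs G D D + k').
have PCS : P (C :|: S).
  rewrite /P subxx /=.
  have := leq_mul (leqnn (2 * t)) (leq_card_setU C S).
  have := arcs_mono G (subsetUl C S); rewrite /k'; lia.
have [D /maxsetP[/andP[sD leD] maxD] _] := @maxset_exists _ P _ PCS.
exists D => //; rewrite /core leD; apply/forallP=> v; apply/implyP=> nDv.
rewrite ltnNge; apply/negP=> leN.
have sDv : D \subset v |: D by exact: subsetU1.
suff PvD : P (v |: D).
  by have /setP/(_ v) := maxD _ PvD sDv; rewrite setU11 (negPf nDv).
have dDv : [disjoint D & [set v]] by rewrite disjoint_sym disjoints1.
apply/andP; split; first exact: subset_trans sD sDv.
rewrite setUC arcsU // {2}/arcs big_set1 setUC cardsU1 nDv; nia.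
Qed.

(** The inequality reads [#|N x :&: C| + #|N x :\: C| / 2 < t], doubled. Written
    with the degree, it visibly becomes harder to satisfy as [C] grows. *)
Definition light C x : bool := (x \notin C) && (degree G x + #|N x :&: C| < 2 * t).

Lemma core_no_light k C : core k C -> (forall x, ~~ light C x) ->
  t * #|V| <= #|edges G| + k.
Proof.
case/andP=> leC _ noL; have dC : [disjoint C & ~: C] by rewrite disjoints_subset setCK.
have := arcsT G; rewrite -(setUCr C) arcsU // mulSn mul1n.
have : #|~: C| * (2 * t) <= 2 * arcs G (~: C) C + arcs G (~: C) (~: C).
  rewrite /arcs big_distrr -big_split -sum_nat_const /=; apply: leq_sum => x.
  rewrite inE => nCx; have := noL x; rewrite /light nCx -leqNgt => /leq_trans; apply.
  by rewrite /degree -/(N x) -(cardsID C (N x)) setDE; lia.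
have := cardsC C; nia.
Qed.

(** Closed neighbourhoods let one condition express several ways of being
    close: for [x] and [y] outside [C], being adjacent, [x] being adjacent to a
    neighbour of [y] outside [C], or having with it a common neighbour outside
    [C]. They also make every light vertex near itself. *)
Definition near C x y : bool :=
  [exists w in (x |: N x) :\: C, exists z in (y |: N y) :\: C, G w z].

Lemma nearP C x y :
  reflect (exists w z, [/\ w \in x |: N x, w \notin C,
                           z \in y |: N y, z \notin C & G w z])
          (near C x y).
Proof.
apply: (iffP exists_inP) => [[w + /exists_inP[z]] | [w [z [xw Cw yz Cz Gwz]]]].
  by rewrite !(in_setD _ C) => /andP[Cw xw] /andP[Cz yz] Gwz; exists w, z.
by exists w; [|apply/exists_inP; exists z]; rewrite // in_setD ?Cw ?Cz.
Qed.

Lemma near_sym C x y : near C x y = near C y x.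
Proof.
by apply/nearP/nearP=> -[w [z []]] *; exists z, w; split; rewrite 1?adj_sym.
Qed.

Lemma light_nbhd_out C x : min_degree_at_least G t -> light C x ->
  exists2 z, G x z & z \notin C.
Proof.
move=> degG /andP[_ ltx]; have lex := degG x.
have /set0Pn[z] : N x :\: C != set0.
  rewrite -card_gt0; move: ltx lex.
  rewrite /degree -/(N x) -(cardsID C (N x)); lia.
by rewrite !inE => /andP[Cz Gxz]; exists z.
Qed.

(** The set-pair inequality is applied to the families [F x] of [p - 2]-cliques
    in [N x :&: C] and [F (g y)], where [g y] is a neighbour of [y] outside [C].
    That they intersect exactly when [x != y] is saturation, used in its two
    directions. *)
Lemma far_light_bound p k C S : 1 < p -> saturated (complete_graph p) G ->
  min_degree_at_least G t -> core k C ->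
  {in S, forall x, light C x} ->
  {in S &, forall x y, x != y -> ~~ near C x y} ->
  #|S| <= (2 ^ t).+1 ^ (2 ^ t).
Proof.
move=> p2 satG degG coreC lightS farS.
pose F x := [set Q in powerset (N x :&: C) | clique G Q & #|Q| == p.-2].
have leF x : x \notin C -> #|F x| <= 2 ^ t.
  move=> /(core_out coreC) /ltnW lex.
  apply: (@leq_trans #|powerset (N x :&: C)|).
    by apply/subset_leq_card/subsetP=> Q; rewrite inE => /andP[].
  by rewrite card_powerset leq_pexp2l.
(* The default [x] is never taken for [x] in [S]. *)
pose g x := odflt x [pick z | G x z && (z \notin C)].
have gP x : x \in S -> G x (g x) /\ g x \notin C.
  move=> /lightS /(light_nbhd_out degG)[z Gxz Cz]; rewrite /g.
  by case: pickP => [z' /andP[]|/(_ z)] //=; rewrite Gxz Cz.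
have outS x : x \in S -> x \notin C by move=> /lightS /andP[].
apply: (@set_pair_bound _ _ F (F \o g)) => [x /outS /leF //|x Sx|x Sx|x y Sx Sy xNy] /=.
- by apply: leF; case: (gP x Sx).
- have [Gxg _] := gP x Sx; apply/pred0P=> Q; apply/negP=> /andP[/=].
  rewrite !inE !subsetI => /and3P[/andP[sQx _] cQ /eqP cardQ] /andP[/andP[sQg _] _].
  have := saturated_adj p2 satG Gxg cQ; rewrite subsetI sQx sQg cardQ eqxx.
  by move/(_ isT).
have [Gyg Cg] := gP y Sy; have Cx := outS x Sx; have Cy := outS y Sy.
have far w z : w \in x |: N x -> w \notin C -> z \in y |: N y -> z \notin C -> ~~ G w z.
  move=> xw Cw yz Cz; apply: contra (farS x y Sx Sy xNy) => Gwz.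
  by apply/nearP; exists w, z.
have yg : g y \in y |: N y by rewrite !inE Gyg orbT.
have nGxg : ~~ G x (g y) by apply: far; rewrite ?setU11.
have xNg : x != g y.
  apply: contraTneq Gyg => <-; rewrite adj_sym; apply: far; rewrite ?setU11 //.
have [Q [cQ cardQ sQ]] := saturated_nonadj satG xNg nGxg.
(* A clique vertex outside [C] would be adjacent to [g y] and a neighbour of
   [x], which makes [x] and [y] near. *)
have sQC : Q \subset C.
  apply/subsetP=> q /(subsetP sQ); rewrite !inE => /andP[Gxq Ggq].
  apply: contraLR Ggq => Cq; rewrite adj_sym; apply: far => //.
  by rewrite !inE Gxq orbT.
move: sQ; rewrite subsetI => /andP[sQx sQg].
by apply/pred0Pn; exists Q; rewrite /= !inE !subsetI sQx sQg sQC cQ cardQ eqxx.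
Qed.

(** * The potential *)

(** Capping at [t], the value given to the members of [C], keeps the rank of a
    vertex of large degree bounded and monotone in [C]. *)
Definition rank C w : nat := if w \in C then t else minn t #|N w :&: C|.

Definition potential C x : nat := \sum_(w in x |: N x) rank C w.

Lemma rank_le C w : rank C w <= t.
Proof. by rewrite /rank; case: ifP => // _; apply: geq_minl. Qed.

Lemma rank_mono C D w : C \subset D -> rank C w <= rank D w.
Proof.
move=> sCD; rewrite /rank; case: ifP => [/(subsetP sCD) -> //|_].
case: ifP => _; first exact: geq_minl.
have := subset_leq_card (setIS (N w) sCD); lia.
Qed.

(** The cap does not hide the gain: a vertex outside a core has fewer than [t]
    neighbours in it. *)
Lemma rank_lt k C D w z : core k C -> C \subset D -> w \notin C ->
  G w z -> z \in D -> z \notin C -> rank C w < rank D w.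
Proof.
move=> coreC sCD Cw Gwz Dz Cz; have ltw := core_out coreC Cw.
rewrite /rank (negPf Cw); case: ifP => _; first lia.
suff : #|N w :&: C| < #|N w :&: D| by lia.
apply/proper_card/properP; split; first exact: setIS.
by exists z; rewrite !inE Gwz ?Dz ?Cz.
Qed.

Lemma potential_lt k C D x y : core k C -> C \subset D -> y |: N y \subset D ->
  near C x y -> potential C x < potential D x.
Proof.
move=> coreC sCD syD /nearP[w [z [xw Cw yz Cz Gwz]]].
rewrite /potential (bigD1 w xw) [ltnRHS](bigD1 w xw) /= -addSn leq_add //.
  exact: (rank_lt coreC sCD Cw Gwz (subsetP syD z yz) Cz).
by apply: leq_sum => v _; apply: rank_mono.
Qed.

Lemma card_closed_nbhd C x : light C x -> #|x |: N x| <= 2 * t.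
Proof.
case/andP=> _; rewrite /degree -/(N x) => ltx.
by rewrite cardsU1 (leq_trans (leq_add (leq_b1 _) (leqnn _))) //; lia.
Qed.

Lemma potential_le C x : light C x -> potential C x <= 2 * t * t.
Proof.
move=> /card_closed_nbhd lex; apply: (@leq_trans (#|x |: N x| * t)).
  by rewrite -sum_nat_const; apply: leq_sum => w _; apply: rank_le.
by rewrite leq_mul2r lex orbT.
Qed.

Lemma light_anti C D x : C \subset D -> light D x -> light C x.
Proof.
move=> sCD /andP[Dx ltx]; apply/andP; split; first by apply: contra Dx; apply: subsetP.
by have := subset_leq_card (setIS (N x) sCD); lia.
Qed.

Lemma near_refl C x : min_degree_at_least G t -> light C x -> near C x x.
Proof.
move=> degG Lx; have [z Gxz Cz] := light_nbhd_out degG Lx.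
apply/nearP; exists x, z; rewrite setU11 !inE Gxz orbT Cz; split=> //.
by case/andP: Lx.
Qed.

(** In a round at most [(2 ^ t).+1 ^ (2 ^ t)] closed neighbourhoods, each of at
    most [2 * t] vertices, are added to the core, at a price of [2 * t] arcs per
    vertex. *)
Definition round_cost : nat := 2 * t * ((2 ^ t).+1 ^ (2 ^ t) * (2 * t)).

(** The number [m] of completed rounds bounds the potential of every light
    vertex from below. No vertex ever becomes light later on, because lightness
    is antitone in the core, so the bound passes to the next round. *)
Lemma potential_step p k m C : 1 < p -> saturated (complete_graph p) G ->
  min_degree_at_least G t -> core k C ->
  (forall x, light C x -> m <= potential C x) ->
  exists2 D, core (k + round_cost) D &
    forall x, light D x -> m < potential D x.
Proof.
move=> p2 satG degG coreC lem.
pose P S := [forall x in S, light C x] &&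
  [forall x in S, forall y in S, (x != y) ==> ~~ near C x y].
have P0 : P set0 by apply/andP; split; apply/forall_inP=> x; rewrite inE.
have [S /maxsetP[/andP[/forall_inP lightS /forall_inP farS] maxS] _] :=
  @maxset_exists _ P _ P0.
have {}farS : {in S &, forall x y, x != y -> ~~ near C x y}.
  by move=> x y Sx Sy; have /forall_inP/(_ y Sy)/implyP := farS x Sx.
(* Maximality of [S]: a light vertex far from all of [S] could be added. *)
have nearS x : light C x -> exists2 y, y \in S & near C x y.
  move=> Lx; apply/exists_inP; apply: contraT => /exists_inPn farx.
  have nSx : x \notin S by apply/negP=> /farx; rewrite near_refl.
  suff Px : P (x |: S).
    by move/setP/(_ x): (maxS _ Px (subsetU1 x S)); rewrite setU11 (negPf nSx).
  apply/andP; split; apply/forall_inP=> u /setU1P[->|Su] //; first exact: lightS.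
    apply/forall_inP=> v /setU1P[->|Sv]; first by rewrite eqxx.
    by rewrite farx ?implybT.
  apply/forall_inP=> v /setU1P[->|Sv]; first by rewrite near_sym farx ?implybT.
  by apply/implyP; apply: farS.
pose W := \bigcup_(y in S) (y |: N y).
have leW : #|W| <= (2 ^ t).+1 ^ (2 ^ t) * (2 * t).
  apply: (@leq_trans (#|S| * (2 * t))).
    by apply: leq_card_bigcup => y /lightS; apply: card_closed_nbhd.
  by rewrite leq_mul2r (far_light_bound p2 satG degG coreC lightS farS) orbT.
have [leC _] := andP coreC.
have [D sD /andP[leD outD]] := core_extend W leC.
exists D.
  rewrite /core outD andbT (leq_trans leD) // !leq_add2l.
  by rewrite /round_cost leq_mul2l leW orbT.
have [sCD sWD] : C \subset D /\ W \subset D by move: sD; rewrite subUset => /andP[].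
move=> x /(light_anti sCD) Lx; have [y Sy xy] := nearS x Lx.
apply: leq_ltn_trans (lem x Lx) (potential_lt coreC sCD _ xy).
exact: subset_trans (bigcup_sup y Sy) sWD.
Qed.

End Core.

Theorem theorem1 (t : nat) :
  exists c : nat,
    forall p : nat, 3 <= p ->
    forall (n : nat) (V : finType) (G : sgraph V),
      #|V| = n ->
      saturated (complete_graph p) G ->
      min_degree_at_least G t ->
      t * n <= #|edges G| + c.
Proof.
exists ((2 * t * t).+1 * round_cost t) => p p3 n V G <- satG degG.
have iter_round m : exists2 C, core G t (m * round_cost t) C &
    forall x, light G t C x -> m <= potential G t C x.
  elim: m => [|m [C coreC lem]].
    have [|D _ coreD] := @core_extend _ G t 0 set0 set0; first by rewrite cards0 muln0.
    by exists D; rewrite // cards0 muln0 in coreD *.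
  have [D coreD ltm] := potential_step (ltnW p3) satG degG coreC lem.
  by exists D; rewrite // mulSn addnC.
have [C coreC leC] := iter_round (2 * t * t).+1.
apply: core_no_light coreC _ => x; apply/negP=> Lx.
by have := leq_trans (leC x Lx) (potential_le Lx); rewrite ltnn.
Qed.
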